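(* For every $n$-vertex tree $T$, $h(T)=O(\log n)$; that is, there is an absolute constant $c$ such that every tree $T$ with $n\ge2$ vertices satisfies $h(T)\le c\log n$.
   Context: Hunters \& Rabbit game on a graph $G$ with $k$ hunters: a hunters' strategy is a sequence $\mathcal H=(H_1,H_2,\ldots)$ of sets $H_i\subseteq V(G)$ with $|H_i|\le k$. A rabbit's strategy is a sequence $(r_0,r_1,\ldots)$ of vertices with $r_i$ adjacent to $r_{i-1}$ for all $i\ge1$. $\mathcal H$ is winning if for every rabbit's strategy there is $i\ge1$ with $r_{i-1}\in H_i$. The hunter number $h(G)$ is the minimum $k$ such that $k$ hunters have a winning strategy on $G$. *)

(* Defs.v *)
From HB Require Import structures.
From mathcomp Require Import all_boot all_order all_algebra.
From mathcomp Require Import boolp.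

Set Implicit Arguments.
Unset Strict Implicit.
Unset Printing Implicit Defensive.

(* A simple graph on the vertex set T is its
   adjacency relation e : rel T. *)
Definition simple_graph (T : finType) (e : rel T) : Prop :=
  symmetric e /\ irreflexive e.

Definition connected_graph (T : finType) (e : rel T) : Prop :=
  0 < #|T| /\ forall x y : T, connect e x y.

(* The bound on the size is needed because ucycle e [:: x; y] holds for every
   edge xy of a simple graph. *)
Definition acyclic_graph (T : finType) (e : rel T) : Prop :=
  forall c : seq T, 3 <= size c -> ~ ucycle e c.

Definition is_tree (T : finType) (e : rel T) : Prop :=
  [/\ simple_graph e, connected_graph e & acyclic_graph e].

Definition rabbit_strategy (T : finType) (e : rel T) (r : nat -> T) : Prop :=
  forall i : nat, e (r i) (r i.+1).

(* A hunters' strategy (H_1, H_2, ...) is indexed from 0: H i stands for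
   H_{i+1}, so that r_{i-1} \in H_i reads r i \in H i. *)
Definition hunters_strategy (T : finType) (k : nat) (H : nat -> {set T}) : Prop :=
  forall i : nat, #|H i| <= k.

Definition winning (T : finType) (e : rel T) (H : nat -> {set T}) : Prop :=
  forall r : nat -> T, rabbit_strategy e r -> exists i : nat, r i \in H i.

Definition hunters_win (T : finType) (e : rel T) (k : nat) : Prop :=
  exists2 H : nat -> {set T}, hunters_strategy k H & winning e H.

Lemma hunters_win_exists (T : finType) (e : rel T) :
  exists k : nat, `[< hunters_win e k >].
Proof.
exists #|T|; apply/asboolP; exists (fun=> [set: T]) => [i|r _].
  exact: max_card.
by exists 0; rewrite inE.
Qed.

Definition hunter_number (T : finType) (e : rel T) : nat :=
  ex_minn (hunters_win_exists e).

(* Main.v *)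
Require Import Defs.
From mathcomp Require Import all_boot all_order all_algebra.
From mathcomp Require Import reals exp.
From mathcomp Require Import boolp zify.
Import Order.TTheory GRing.Theory Num.Theory.

(** Order the vertices so that every prefix of the ordering has a boundary of
logarithmic size. Shooting, at each step, the boundary of the current prefix
together with the next vertex keeps the rabbit out of a growing prefix, so
that it is eventually caught.

To find the ordering of a vertex set [A], fix a root [r] in [A], which is
counted as a boundary vertex from its appearance on. If [A] minus [r] splits
into two nonempty parts without edges between them, order first [A] minus the
smaller part [C], keeping the root [r], and then [C]; the vertex [r] adds one to
the boundary in the second phase, where the size has been halved. Otherwise
[A] minus [r] is connected, hence by acyclicity it contains at most one
neighbour [c] of [r]: order it with root [c] and finish with [r]. *)

Section Layout.

Context {T : finType} (e : rel T).

(** The root counts unconditionally: when [A] is ordered as part of a larger set, [r] is the only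
    vertex of [A] that may have neighbours placed after all of [A]. *)
Definition rooted_boundary (A : {set T}) (r : T) (p : seq T) : {set T} :=
  [set x in p | (x == r) || [exists y in A, (y \notin p) && e x y]].

(** A rabbit that enters the prefix comes from outside it, so it lands on the boundary and is shot
    there. The extra hunter shoots each vertex just before it joins the prefix. *)
Lemma hunters_win_layout (s : seq T) (r : T) (k : nat) :
    symmetric e -> s =i [set: T] ->
    (forall i, #|rooted_boundary [set: T] r (take i s)| <= k) ->
  hunters_win e k.+1.
Proof.
move=> syme sT bk.
exists (fun i => nth r s i |: rooted_boundary [set: T] r (take i s)).
  by move=> i; rewrite cardsU1; have := bk i; case: (_ \notin _) => /=; lia.
move=> f fe; apply: contrapT => /forallNP missed.
have avoid i : i <= size s -> f i \notin take i s.
  elim: i => [|i IH] lt_is; first by rewrite take0.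
  apply/negP => fiS; apply: (missed i.+1).
  rewrite !inE fiS /=; apply/orP; right; apply/orP; right.
  apply/existsP; exists (f i); rewrite inE syme fe andbT /=.
  rewrite (take_nth r) // mem_rcons inE negb_or IH ?(ltnW lt_is) // andbT.
  by apply/eqP => fiE; apply: (missed i); rewrite !inE fiE eqxx.
have := avoid (size s) (leqnn _); rewrite take_size.
by rewrite sT inE.
Qed.

(** Otherwise a simple path from [x] to [y] inside [D] would close up through [r] to a cycle. *)
Lemma unique_neighbour_of_connected (D : {set T}) (r x y : T) :
    symmetric e -> acyclic_graph e -> r \notin D ->
    (forall C : {set T}, C \subset D -> C != set0 ->
       (forall u v, u \in C -> v \in D -> e u v -> v \in C) -> C = D) ->
    x \in D -> y \in D -> e r x -> e r y ->
  x = y.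
Proof.
move=> syme acyc rD Dconn xD yD erx ery; apply/eqP/negPn/negP => xy.
pose eD := [rel u v | [&& e u v, u \in D & v \in D]].
have compD : [set z in D | connect eD x z] = D.
  apply: Dconn.
  - by apply/subsetP => z; rewrite inE => /andP[].
  - by apply/set0Pn; exists x; rewrite inE xD connect0.
  - move=> u v; rewrite !inE => /andP[uD xu] vD euv; rewrite vD /=.
    by apply: connect_trans xu (connect1 _); rewrite /= euv uD vD.
have : connect eD x y by move: yD; rewrite -compD inE => /andP[].
case/connectP=> p0 p0P; case: (shortenP p0P) => p pP p_uniq _ y_p.
have pD : all (mem D) p.
  elim: p {p_uniq y_p} x pP {p0P xy erx xD compD} => //= a p IH x.
  by case/andP=> /and3P[_ _ aD] /IH ->; rewrite aD.
apply: (acyc [:: r, x & p]).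
  (* As [x] and [y] differ, the path has an edge and the cycle at least three vertices. *)
  by case: p y_p {pP p_uniq pD} xy => //= ->; rewrite eqxx.
apply/andP; split.
  rewrite /= erx rcons_path -y_p (syme y) ery andbT.
  by apply: sub_path pP => u v /and3P[].
rewrite cons_uniq p_uniq andbT inE negb_or.
apply/andP; split; first by apply: contraNneq rD => ->.
by apply: contra rD => /(allP pD).
Qed.

Lemma layout_exists (A : {set T}) (r : T) (k : nat) :
    symmetric e -> acyclic_graph e -> r \in A -> #|A| < 2 ^ k ->
  exists2 s : seq T, s =i A &
    forall i, #|rooted_boundary A r (take i s)| <= k.
Proof.
move=> syme acyc.
have [n] := ubnP #|A|; elim: n A r k => // n IH A r k leAn rA ltAk.
set D := A :\ r.
have cardD : #|A| = #|D|.+1 by rewrite (cardsD1 r) rA.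
have k_gt0 : 0 < k by case: k ltAk => //; rewrite cardD.
pose separated (C : {set T}) := [&& C \subset D, C != set0, C != D &
  [forall u in C, forall v in D, e u v ==> (v \in C)]].
have [/existsP[C0 sepC0]|/existsPn nsep] := boolP [exists C, separated C].
  (* By symmetry of [e], the complement in [D] of a separated set is separated. *)
  have [C sepC small] : exists2 C, separated C & #|C| <= #|D :\: C|.
    have [small|/ltnW] := leqP #|C0| #|D :\: C0|; first by exists C0.
    have /and4P[C0D C0n0 C0nD /forallP C0cl] := sepC0.
    have DDC0 : D :\: (D :\: C0) = C0.
      by rewrite setDDr setDv set0U; apply/setIidPr.
    exists (D :\: C0); last by rewrite DDC0.
    apply/and4P; split.
    - exact: subsetDl.
    - by rewrite setD_eq0; apply: contra C0nD => DC0; rewrite eqEsubset C0D.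
    - by apply: contra C0n0 => /eqP E; rewrite -DDC0 E setDv.
    - apply/forall_inP => u; rewrite inE => /andP[uC uD].
      apply/forall_inP => v vD; apply/implyP => euv; rewrite inE vD andbT.
      apply: contra uC => vC.
      move/forall_inP/(_ _ uD)/implyP: (implyP (C0cl v) vC); apply.
      by rewrite syme.
  have /and4P[CD Cn0 _ /forall_inP Ccl] := sepC.
  have {}Ccl u v : u \in C -> v \in A -> v != r -> e u v -> v \in C.
    move=> uC vA vr euv.
    by have /forall_inP/(_ v)/implyP := Ccl u uC; rewrite !inE vr vA euv; apply.
  have CA : C \subset A := subset_trans CD (subsetDl _ _).
  have rC : r \notin C by apply/negP => /(subsetP CD); rewrite !inE eqxx.
  have /set0Pn[c cC] := Cn0.
  have C_gt0 : 0 < #|C| by apply/card_gt0P; exists c.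
  move: (cardsID C D) (cardsID C A); rewrite (setIidPr CD) (setIidPr CA).
  move=> DE AE.
  have [||| s1 s1A b1] := IH (A :\: C) r k; [lia | by rewrite inE rC | lia |].
  (* At most half of [D] lies in [C], so [k.-1] suffices there and leaves room for [r]. *)
  have kE : 2 ^ k = 2 * 2 ^ k.-1 by rewrite -expnS prednK.
  have [||| s2 s2C b2] := IH C c k.-1; [lia | done | lia |].
  exists (s1 ++ s2).
    move=> z; rewrite mem_cat s1A s2C inE; case: (boolP (z \in C)) => //=.
      by move/(subsetP CA) => ->.
    by rewrite orbF.
  (* In [A :\: C] only [r] can have neighbours in [C], and it is counted already. *)
  move=> i; rewrite take_cat; case: ltnP => [lt_is|_].
    apply: leq_trans (b1 i); apply/subset_leq_card/subsetP => z.
    rewrite !inE => /andP[zs] /orP[/eqP zr | /existsP[y /and3P[yA ys ezy]]].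
      by rewrite zs zr eqxx.
    rewrite zs /=; have [//|zr /=] := eqVneq z r.
    apply/existsP; exists y; rewrite inE yA ys ezy !andbT.
    have := mem_take zs; rewrite s1A inE => /andP[zC zA].
    by apply: contra zC => yC; apply: (Ccl y) => //; rewrite syme.
  set j := i - size s1.
  apply: (@leq_trans #|r |: rooted_boundary C c (take j s2)|); last first.
    by rewrite cardsU1; have := b2 j; case: (_ \notin _) => /=; lia.
  apply/subset_leq_card/subsetP => z; rewrite !inE mem_cat.
  have [//|zr /=] := eqVneq z r.
  case/andP=> zs /existsP[y /and3P[yA]].
  rewrite mem_cat negb_or s1A inE yA andbT negbK => /andP[yC ys] ezy.
  have zA : z \in A.
    by case/orP: zs => [|/mem_take]; rewrite ?s1A ?s2C ?inE;
       [case/andP | move/(subsetP CA)].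
  have zC : z \in C by apply: (Ccl y) => //; rewrite syme.
  move: zs; rewrite s1A inE zC /= => -> /=.
  by apply/orP; right; apply/existsP; exists y; rewrite yC ys.
have Dconn (C : {set T}) : C \subset D -> C != set0 ->
    (forall u v, u \in C -> v \in D -> e u v -> v \in C) -> C = D.
  move=> CD Cn0 Ccl; apply/eqP/negPn/negP => CnD.
  have /negP := nsep C; apply; apply/and4P; split=> //.
  apply/forall_inP => u uC; apply/forall_inP => v vD; apply/implyP.
  exact: Ccl.
have rD : r \notin D by rewrite !inE eqxx.
have [D0|[c0 c0D]] := set_0Vmem D.
  exists [:: r].
    by move=> z; rewrite inE -(setD1K rA) -/D D0 setU0 inE.
  move=> i; apply: (leq_trans _ k_gt0); rewrite -(cards1 r).
  apply/subset_leq_card/subsetP => z; rewrite !inE => /andP[/mem_take].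
  by rewrite inE.
have [c cD c_only] : exists2 c, c \in D & forall x, x \in D -> e r x -> x = c.
  have [/exists_inP[c cD erc]|/exists_inPn none] :=
    boolP [exists c in D, e r c].
    by exists c => // x xD erx; apply: (@unique_neighbour_of_connected D r).
  (* If [r] has no neighbour in [D], any vertex of [D] may serve as its root. *)
  by exists c0 => // x /none/negbTE ->.
have [||| s sD bs] := IH D c k; [lia | done | lia |].
exists (rcons s r).
  by move=> z; rewrite mem_rcons inE sD -(setD1K rA) !inE; case: eqVneq.
(* While [r] is missing, the only vertex it can add to the boundary is [c], the root of [D], which
   is counted anyway. *)
move=> i; have [le_is|gt_is] := leqP i (size s).
  rewrite -cats1 takel_cat //.
  apply: leq_trans (bs i); apply/subset_leq_card/subsetP => z.
  rewrite !inE => /andP[zs]; have zD : z \in D by rewrite -sD (mem_take zs).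
  rewrite zs /=; have [zr|zr /=] := eqVneq z r.
    by rewrite zr (negPf rD) in zD.
  case/existsP=> y /and3P[yA ys ezy]; have [yr|yr] := eqVneq y r.
    by rewrite (c_only z) ?eqxx // syme -yr.
  by apply/orP; right; apply/existsP; exists y; rewrite !inE yr yA ys ezy.
rewrite take_oversize ?size_rcons //; apply: leq_trans k_gt0; rewrite -(cards1 r).
apply/subset_leq_card/subsetP => z; rewrite !inE => /andP[_ /orP[//|]].
case/existsP=> y /and3P[yA]; rewrite mem_rcons !inE sD !inE yA andbT.
by case: (y == r).
Qed.

End Layout.

(** One unit comes from the strict inequality in [layout_exists], the other from the hunter at the
    next vertex. *)
Lemma hunter_number_le_trunc_log {T : finType} {e : rel T} :
    symmetric e -> acyclic_graph e -> 0 < #|T| ->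
  hunter_number e <= (trunc_log 2 #|T|).+2.
Proof.
move=> syme acyc /card_gt0P[r _].
rewrite /hunter_number; case: ex_minnP => m _; apply; apply/asboolP.
have [||s sT bs] := @layout_exists T e setT r (trunc_log 2 #|T|).+1 syme acyc.
- by rewrite inE.
- by rewrite cardsT trunc_log_ltn.
exact: hunters_win_layout syme sT bs.
Qed.

Theorem theorem13 (R : realType) :
  exists c : R, forall (T : finType) (e : rel T),
    is_tree e -> (2 <= #|T|)%N ->
    ((hunter_number e)%:R <= c * ln (#|T|%:R : R))%R.
Proof.
have ln2_gt0 : (0 < ln (2 : R))%R by rewrite ln_gt0 // ltr1n.
(* With [t] the truncated binary logarithm of the order, [t + 2 <= 3 * t] since [t] is positive, and
   [2 ^ t <= #|T|] bounds [t * ln 2]. *)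
exists (3 / ln 2)%R => T e [[syme _] _ acyc] T_ge2.
have T_gt0 : 0 < #|T| by apply: leq_trans T_ge2.
set t := trunc_log 2 #|T|.
have t_gt0 : 0 < t by rewrite trunc_log_gt0.
apply: (@le_trans _ _ (3 * t%:R)%R).
  rewrite -natrM ler_nat.
  by apply: leq_trans (hunter_number_le_trunc_log syme acyc T_gt0) _; lia.
rewrite -mulrA ler_pM2l ?ltr0n // mulrC ler_pdivlMr //.
rewrite mulr_natl -lnXn ?ltr0n // -natrX ler_ln ?posrE ?ltr0n ?expn_gt0 //.
by rewrite ler_nat trunc_logP.
Qed.
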